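(* Let $T>0$, $n\ge1$. Let $H_i$ ($i\in\mathbb{N}$) and $H$ be functions $[0,T]\times\mathbb{R}^n\times\mathbb{R}^n\to\mathbb{R}$, let $c_i,c:[0,T]\to[0,+\infty)$ and $\lambda_i,\lambda:[0,T]\times\mathbb{R}^n\to\mathbb{R}$, and suppose that each of the triples $(H_i,c_i,\lambda_i)$, $i\in\mathbb{N}$, and $(H,c,\lambda)$ is admissible in the sense of the context. Assume that $H_i,\lambda_i,c_i$ are continuous for every $i\in\mathbb{N}$. Let $(f_i,l_i)$ be the pair canonically associated with $(H_i,c_i,\lambda_i)$ and $(f,l)$ the pair canonically associated with $(H,c,\lambda)$, as defined in the context. If $H_i,\lambda_i,c_i$ converge uniformly on compact sets to $H,\lambda,c$, respectively, then $f_i$ converge to $f$ and $l_i$ converge to $l$ uniformly on compact subsets of $[0,T]\times\mathbb{R}^n\times\mathbb{B}$, where $\mathbb{B}$ is the closed unit ball of $\mathbb{R}^{n+1}$.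
   Context: $\mathbb{B}_R$ is the closed ball of radius $R$ about $0$ in $\mathbb{R}^n$; ''measurable'' means Lebesgue measurable; $\operatorname{dom}\varphi=\{x:\varphi(x)\ne\pm\infty\}$. Admissible triple. A triple $(H,c,\lambda)$, with $L(t,x,v):=\sup_{p\in\mathbb{R}^n}\{\langle v,p\rangle-H(t,x,p)\}$, is called admissible if: (1) $H(\cdot,x,p)$ is measurable for all $x,p$; $H(t,\cdot,\cdot)$ is continuous for all $t$; $H(t,x,\cdot)$ is convex for all $(t,x)$. (2) $c$ is measurable and $|H(t,x,p)-H(t,x,q)|\le c(t)(1+|x|)|p-q|$ for all $t\in[0,T]$, $x,p,q\in\mathbb{R}^n$. (3) For every $R>0$ there is a measurable $k_R:[0,T]\to[0,+\infty)$ with $|H(t,x,p)-H(t,y,p)|\le k_R(t)(1+|p|)|x-y|$ for all $t\in[0,T]$, $x,y\in\mathbb{B}_R$, $p\in\mathbb{R}^n$. (4) $\lambda$ is measurable in $t$ and continuous in $x$, $L(t,x,v)\le\lambda(t,x)$ for all $(t,x)$ and $v\in\operatorname{dom}L(t,x,\cdot)$, and for every $R>0$ there is a measurable $k_R:[0,T]\to[0,+\infty)$ such that $\lambda(t,\cdot)$ is $k_R(t)$-Lipschitz on $\mathbb{B}_R$ for every $t$. Canonical pair. For an admissible triple put $E_L(t,x):=\{(v,\eta)\in\mathbb{R}^n\times\mathbb{R}: L(t,x,v)\le\eta\}$ (a nonempty closed convex subset of $\mathbb{R}^{n+1}$), $\omega(t,x):=|\lambda(t,x)|+|H(t,x,0)|+c(t)(1+|x|)+1$,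 and, for $a\in\mathbb{R}^{n+1}$, $$\Phi(t,x,a):=E_L(t,x)\cap \mathbb{B}\big(\omega(t,x)a,\,2d(\omega(t,x)a,E_L(t,x))\big),\qquad \mathsf{e}(t,x,a):=s_{n+1}(\Phi(t,x,a)),$$ where $\mathbb{B}(y,r)$ is the closed ball of centre $y$ and radius $r$ in $\mathbb{R}^{n+1}$, $d(y,K)=\inf_{z\in K}|y-z|$, and $s_m(K)$ is the Steiner point of a nonempty compact convex $K\subset\mathbb{R}^m$ ($m\geq 2$): $s_m(K)=m\int_{S^{m-1}}p\,\sigma(K,p)\,\mu(dp)$, with $\sigma(K,p)=\max_{x\in K}\langle p,x\rangle$ and $\mu$ the normalized ($\mu(S^{m-1})=1$) Lebesgue surface measure on the unit sphere $S^{m-1}$. The canonical pair $(f,l)$ is given by $\mathsf{e}(t,x,a)=(f(t,x,a),l(t,x,a))\in\mathbb{R}^n\times\mathbb{R}$ for $a\in\mathbb{B}$ (closed unit ball of $\mathbb{R}^{n+1}$). It satisfies $H(t,x,p)=\sup_{a\in\mathbb{B}}\{\langle p,f(t,x,a)\rangle-l(t,x,a)\}$. *)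

(* Defs.v *)
From HB Require Import structures.
From mathcomp Require Import all_boot all_order all_algebra.
From mathcomp Require Import all_classical all_reals all_analysis.
From mathcomp Require Import measurable_realfun.
From mathcomp Require Import ring lra.

Set Implicit Arguments.
Unset Strict Implicit.
Unset Printing Implicit Defensive.

Import Order.TTheory GRing.Theory Num.Theory.
Import numFieldNormedType.Exports.

Local Open Scope classical_set_scope.
Local Open Scope ring_scope.

(* Points of R^n are row vectors. The norm [`|x|] of the library on ['rV[R]_n]
   is the sup norm; every metric notion below uses [enorm] instead. *)
Definition dotp (R : realType) (n : nat) (x y : 'rV[R]_n) : R :=
  \sum_(i < n) x 0 i * y 0 i.

Definition enorm (R : realType) (n : nat) (x : 'rV[R]_n) : R :=
  Num.sqrt (dotp x x).

Definition eball (R : realType) (n : nat) (x : 'rV[R]_n) (r : R) :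
  set 'rV[R]_n := [set y | enorm (y - x) <= r].

Definition edist (R : realType) (n : nat) (x : 'rV[R]_n) (K : set 'rV[R]_n) :
  R := inf [set enorm (x - z) | z in K].

Definition rV_display : measure_display.
Proof. exact: default_measure_display. Qed.

(* The sigma-algebra generated by the coordinates, i.e. the Borel one. *)
Section rV_measurable.
Context (R : realType) (n : nat).

Definition rV_coord (i : 'I_n) (x : 'rV[R]_n) : measurableTypeR R := x 0 i.

Let rV_set0 : g_sigma_preimage rV_coord set0.
Proof. exact: sigma_algebra0. Qed.

Let rV_setC A : g_sigma_preimage rV_coord A -> g_sigma_preimage rV_coord (~` A).
Proof. exact: sigma_algebraC. Qed.

Let rV_bigcup (F : _^nat) : (forall i, g_sigma_preimage rV_coord (F i)) ->
  g_sigma_preimage rV_coord (\bigcup_i (F i)).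
Proof. exact: sigma_algebra_bigcup. Qed.

HB.instance Definition _ := @isMeasurable.Build rV_display
  'rV[R]_n (g_sigma_preimage rV_coord) rV_set0 rV_setC rV_bigcup.

End rV_measurable.

Definition rV_cons (R : realType) (n : nat) (p : measurableTypeR R * 'rV[R]_n) :
  'rV[R]_n.+1 := row_mx (p.1 : R)%:M p.2 : 'rV[R]_(1 + n).

(* n-dimensional Lebesgue measure as an iterated product measure. *)
Fixpoint rV_lebesgue (R : realType) (n : nat) : set 'rV[R]_n -> \bar R :=
  match n return set 'rV[R]_n -> \bar R with
  | 0 => @dirac _ 'rV[R]_0 0 R
  | m.+1 => pushforward
      (product_measure1 (@lebesgue_measure R) (@rV_lebesgue R m)) (@rV_cons R m)
  end.

Section rV_lebesgue_measure.
Context (R : realType).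

Lemma measurable_rV_coord (n : nat) (i : 'I_n) :
  measurable_fun [set: 'rV[R]_n] (@rV_coord R n i).
Proof.
move=> _ Y mY; rewrite setTI; apply: sub_sigma_algebra => /=.
rewrite -bigcup_seq/=; exists i => /=; first by rewrite mem_index_enum.
by exists Y => //; rewrite setTI.
Qed.

Lemma measurable_rVP d (T : measurableType d) (n : nat) (f : T -> 'rV[R]_n) :
  measurable_fun setT f <->
  forall i, measurable_fun setT (@rV_coord R n i \o f).
Proof.
split=> [mf i|mf].
  by apply: measurableT_comp => //; exact: measurable_rV_coord.
move=> _ A mA; rewrite setTI.
suff : preimage_set_system setT f (@g_sigma_preimage _ _ _ n (@rV_coord R n))
    `<=` measurable.
  by apply; exists A => //; rewrite setTI.
rewrite -g_sigma_preimage_comp.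
apply: smallest_sub; first exact: sigma_algebra_measurable.
case: n f mf A mA => [|n] f mf A mA; first by rewrite big_ord0.
rewrite -bigcup_mkord_ord; apply: bigcup_sub => i Ii.
by move=> B [C mC <-]; exact: mf.
Qed.

Lemma measurable_rV_cons (n : nat) : measurable_fun setT (@rV_cons R n).
Proof.
apply/measurable_rVP => i; rewrite /rV_cons /rV_coord /=.
rewrite (_ : _ \o _ = fun p : measurableTypeR R * 'rV[R]_n =>
   match fintype.split (i : 'I_(1 + n)) with inl _ => p.1 | inr j => @rV_coord R n j p.2 end); last first.
  apply/funext => p /=; rewrite mxE; case: splitP => j // ij.
  by rewrite ord1 mxE.
case: (fintype.split (i : 'I_(1 + n))) => j; first exact: measurable_fst.
by apply: measurableT_comp; [exact: measurable_rV_coord|exact: measurable_snd].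
Qed.

Definition rV_uncons (n : nat) (x : 'rV[R]_n.+1) : measurableTypeR R * 'rV[R]_n :=
  (x 0 0, rsubmx (x : 'rV_(1 + n))).

Lemma rV_unconsK (n : nat) : cancel (@rV_uncons n) (@rV_cons R n).
Proof.
move=> x; rewrite /rV_cons /rV_uncons /=.
apply/rowP => i; rewrite mxE.
case: splitP => j ij.
  rewrite ord1 mxE eqxx mulr1n; congr (x _ _); apply/val_inj => /=.
  by rewrite ij ord1.
by rewrite mxE; congr (x _ _); apply/val_inj.
Qed.

Lemma rV_consK (n : nat) : cancel (@rV_cons R n) (@rV_uncons n).
Proof.
move=> [a x]; rewrite /rV_cons /rV_uncons /= row_mxKr; congr pair.
rewrite mxE; case: splitP => j // ij.
by rewrite ord1 mxE eqxx mulr1n.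
Qed.

Lemma measurable_rV_uncons (n : nat) : measurable_fun setT (@rV_uncons n).
Proof.
apply/measurable_fun_pair; first exact: (@measurable_rV_coord n.+1 0).
apply/measurable_rVP => i.
rewrite (_ : _ \o _ = @rV_coord R n.+1 (@rshift 1%N n i)); last first.
  by apply/funext => x /=; rewrite /rV_coord mxE.
exact: measurable_rV_coord.
Qed.

Section rV_lebesgue_step.
Variables (n : nat) (mu : {sigma_finite_measure set 'rV[R]_n -> \bar R}).

Let nu := product_measure1 (@lebesgue_measure R) mu.

Let step := pushforward nu (@rV_cons R n).

Let mcons := @measurable_rV_cons n.

Let step0 : step set0 = 0%E.
Proof. exact: measure0. Qed.

Let step_ge0 A : (0 <= step A)%E.
Proof. exact: measure_ge0. Qed.

Let step_additive : semi_sigma_additive step.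
Proof. exact: measure_semi_sigma_additive. Qed.

HB.instance Definition _ := isMeasure.Build _ _ _ step
  step0 step_ge0 step_additive.

Let nu_sigma_finite : sigma_finite setT nu.
Proof.
have /sigma_finiteP[F [TF ndF Foo]] := sigma_finiteT (@lebesgue_measure R).
have /sigma_finiteP[G [TG ndG Goo]] := sigma_finiteT mu.
exists (fun k => F k `*` G k).
  rewrite -setXTT TF TG predeqE => -[x y]; split.
    move=> [/= [i _ Fix] [k _ Gky]]; exists (maxn i k) => //; split.
    - by move: x Fix; exact/subsetPset/ndF/leq_maxl.
    - by move: y Gky; exact/subsetPset/ndG/leq_maxr.
  by move=> [k _ []/= ? ?]; split; exists k.
move=> k; have [mF ?] := Foo k; have [mG ?] := Goo k.
split; first exact: measurableX.
by rewrite /nu product_measure1E// lte_mul_pinfty// ge0_fin_numE.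
Qed.

Let step_sigma_finite : sigma_finite setT step.
Proof.
have [F FT Foo] := nu_sigma_finite.
exists (fun k => @rV_uncons n @^-1` F k).
  by rewrite -preimage_bigcup -FT preimage_setT.
move=> k; have [mF nuF] := Foo k; split.
  by rewrite -[X in measurable X]setTI; exact: measurable_rV_uncons.
rewrite /step /pushforward (_ : _ @^-1` _ = F k)//.
by apply/seteqP; split => x /=; rewrite rV_consK.
Qed.

HB.instance Definition _ := Measure_isSigmaFinite.Build _ _ _ step
  step_sigma_finite.

Lemma rV_lebesgue_step : exists m : {sigma_finite_measure set 'rV[R]_n.+1 -> \bar R},
  (m : set _ -> _) = step.
Proof. by exists step. Qed.

End rV_lebesgue_step.

Lemma rV_lebesgue_is_measure (n : nat) :
  exists mu : {sigma_finite_measure set 'rV[R]_n -> \bar R},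
    (mu : set _ -> _) = @rV_lebesgue R n.
Proof.
elim: n => [|n [mu IH]] /=; first by exists (@dirac _ 'rV[R]_0 0 R).
by rewrite -IH; exact: rV_lebesgue_step.
Qed.

Let rV_lebesgue0 (n : nat) : @rV_lebesgue R n set0 = 0%E.
Proof. by have [mu <-] := rV_lebesgue_is_measure n; exact: measure0. Qed.

Let rV_lebesgue_ge0 (n : nat) A : (0 <= @rV_lebesgue R n A)%E.
Proof. by have [mu <-] := rV_lebesgue_is_measure n; exact: measure_ge0. Qed.

Let rV_lebesgue_additive (n : nat) : semi_sigma_additive (@rV_lebesgue R n).
Proof.
have [mu <-] := rV_lebesgue_is_measure n.
exact: measure_semi_sigma_additive.
Qed.

HB.instance Definition _ (n : nat) := isMeasure.Build _ _ _ (@rV_lebesgue R n)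
  (@rV_lebesgue0 n) (@rV_lebesgue_ge0 n) (@rV_lebesgue_additive n).

Let rV_lebesgue_sigma_finite (n : nat) : sigma_finite setT (@rV_lebesgue R n).
Proof.
by have [mu <-] := rV_lebesgue_is_measure n; exact: sigma_finiteT.
Qed.

HB.instance Definition _ (n : nat) := Measure_isSigmaFinite.Build _ _ _
  (@rV_lebesgue R n) (@rV_lebesgue_sigma_finite n).

Lemma rV_lebesgue_box (n : nat) (A : 'I_n -> set (measurableTypeR R)) :
  (forall i, measurable (A i)) ->
  rV_lebesgue [set x : 'rV[R]_n | forall i, A i (x 0 i)] =
  (\prod_(i < n) lebesgue_measure (A i))%E.
Proof.
elim: n A => [|n IH] A mA.
  rewrite big_ord0 /= diracE mem_set//=; by case.
have mB : measurable [set x : 'rV[R]_n | forall i, A (lift ord0 i) (x 0 i)].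
  rewrite (_ : mkset _ =
      \bigcap_(i in [set: 'I_n]) (@rV_coord R n i @^-1` A (lift ord0 i))).
    apply: fin_bigcap_measurable; first exact: finite_finset.
    move=> i _; rewrite -[X in measurable X]setTI.
    exact: measurable_rV_coord.
  apply/seteqP; split => x /= H i; first by move=> _; exact: H.
  exact: H.
rewrite big_ord_recl /= -IH; last by move=> i; exact: mA.
rewrite -product_measure1E//; congr (product_measure1 _ _ _).
apply/seteqP; split => -[a x] /=.
  move=> H; split.
    have := H ord0; rewrite /rV_cons mxE; case: splitP => // j _.
    by rewrite ord1 mxE eqxx mulr1n.
  move=> i; have := H (lift ord0 i); rewrite /rV_cons mxE.
  case: splitP => j //=; first by move: (ltn_ord j); case: (nat_of_ord j).
  by rewrite /bump /= !add1n => -[] /ord_inj <-.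
move=> [Aa Ax] i; rewrite /rV_cons mxE; case: splitP => j ij.
  by rewrite ord1 mxE eqxx mulr1n (_ : i = ord0)//; apply/val_inj; rewrite /= ij ord1.
by rewrite /= (_ : i = lift ord0 j)//; apply/val_inj; rewrite /= ij.
Qed.

End rV_lebesgue_measure.

Definition esphere (R : realType) (n : nat) : set 'rV[R]_n :=
  [set x | enorm x = 1].

Definition radial (R : realType) (n : nat) (x : 'rV[R]_n) : 'rV[R]_n :=
  (enorm x)^-1 *: x.

(* The normalized surface measure of the unit sphere, extended by 0 to R^n:
   the surface area of A is proportional to the volume of the cone
   { r p | 0 <= r <= 1, p \in A } over it. *)
Definition sphere_measure (R : realType) (n : nat) (A : set 'rV[R]_n) : \bar R :=
  (rV_lebesgue (eball 0 1 `&` @radial R n @^-1` A)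
   * (fine (rV_lebesgue (eball (0 : 'rV[R]_n) 1)))^-1%:E)%E.

Section sphere_measure_facts.
Context (R : realType) (n : nat).
Implicit Types x : 'rV[R]_n.

Lemma dotp_ge0 x : 0 <= dotp x x.
Proof. by apply: sumr_ge0 => i _; rewrite -expr2 sqr_ge0. Qed.

Lemma measurable_enorm :
  measurable_fun setT (fun x => enorm x : measurableTypeR R).
Proof.
apply: (@measurableT_comp _ _ _ _ _ _ (fun r : R => Num.sqrt r)).
  apply: continuous_measurable_fun; exact: sqrt_continuous.
apply: measurable_sum => i.
by apply: measurable_funM; exact: (@measurable_rV_coord R n i).
Qed.

Lemma measurable_eball0 (r : R) : measurable (eball (0 : 'rV[R]_n) r).
Proof.
rewrite (_ : eball 0 r = (fun x => enorm x : measurableTypeR R) @^-1` `]-oo, r]).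
  by rewrite -[X in measurable X]setTI; exact: measurable_enorm.
by apply/seteqP; split => x; rewrite /eball /= subr0 in_itv.
Qed.

Lemma measurable_esphere : measurable (@esphere R n).
Proof.
rewrite (_ : @esphere R n = (fun x => enorm x : measurableTypeR R) @^-1` [set 1]) //.
by rewrite -[X in measurable X]setTI; exact: measurable_enorm.
Qed.

Lemma measurable_radial : measurable_fun setT (@radial R n).
Proof.
apply/measurable_rVP => i.
rewrite (_ : _ \o _ = fun x => (enorm x)^-1 * x 0 i); last first.
  by apply/funext => x; rewrite /rV_coord /= mxE.
apply: measurable_funM; last exact: (@measurable_rV_coord R n i).
rewrite (_ : (fun x => _) = fun x : 'rV[R]_n => powR (enorm x) (-1)); last first.
  by apply/funext => x; rewrite powR_inv1// sqrtr_ge0.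
by apply: (measurableT_comp (measurable_powR _)); exact: measurable_enorm.
Qed.

Lemma unit_ball_volume :
  (0 < rV_lebesgue (eball (0 : 'rV[R]_n) 1) < +oo)%E.
Proof.
have box (r : R) : 0 <= r ->
    rV_lebesgue [set x : 'rV[R]_n | forall i, `[- r, r]%classic (x 0 i)] =
    ((r + r) ^+ n)%:E.
  move=> r0; rewrite (@rV_lebesgue_box R n (fun=> `[- r, r]%classic))//.
  rewrite (eq_bigr (fun=> (r + r)%:E)); last first.
    move=> i _; rewrite lebesgue_measure_itv /= lte_fin.
    case: ltP => rr; first by rewrite opprK.
    have -> : r = 0 by apply/eqP; rewrite eq_le r0 andbT; lra.
    by rewrite addr0.
  elim: (n) => [|k IH]; first by rewrite big_ord0.
  by rewrite big_ord_recl IH exprS.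
have mbox (r : R) : measurable [set x : 'rV[R]_n | forall i, `[- r, r]%classic (x 0 i)].
  rewrite (_ : mkset _ =
      \bigcap_(i in [set: 'I_n]) (@rV_coord R n i @^-1` `[- r, r])).
    apply: fin_bigcap_measurable; first exact: finite_finset.
    move=> i _; rewrite -[X in measurable X]setTI.
    by apply: measurable_rV_coord => //; exact: measurable_itv.
  apply/seteqP; split => x /= H i; first by move=> _; exact: H.
  exact: H.
apply/andP; split.
  pose r : R := n.+1%:R^-1.
  have r0 : 0 < r by rewrite invr_gt0.
  apply: (@lt_le_trans _ _ (((r + r) ^+ n)%:E)).
    by rewrite lte_fin exprn_gt0// addr_gt0.
  rewrite -box; last exact: ltW.
  apply: le_measure; rewrite ?inE; [exact: mbox|exact: measurable_eball0|].
  move=> x /= xr; rewrite /eball /= subr0.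
  rewrite -[leRHS]sqrtr1 ler_wsqrtr//.
  apply: (@le_trans _ _ (\sum_(i < n) r)).
    apply: ler_sum => i _; have := xr i; rewrite in_itv /= => /andP[x1 x2].
    have rl1 : r <= 1 by rewrite invf_le1// ler1n.
    nra.
  rewrite sumr_const card_ord -mulr_natl /r ler_pdivrMr//.
  by rewrite mul1r ler_nat.
apply: (@le_lt_trans _ _ (((1 + 1 : R) ^+ n)%:E)); last exact: ltry.
rewrite -box//.
apply: le_measure; rewrite ?inE; [exact: measurable_eball0|exact: mbox|].
move=> x; rewrite /eball /= subr0 => x1 i.
rewrite in_itv /= -ler_norml -sqrtr_sqr.
apply: le_trans x1; rewrite ler_wsqrtr// /dotp (bigD1 i)//= -expr2 lerDl.
by apply: sumr_ge0 => j _; rewrite -expr2 sqr_ge0.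
Qed.

Let c_ge0 : 0 <= (fine (rV_lebesgue (eball (0 : 'rV[R]_n) 1)))^-1.
Proof. by rewrite invr_ge0 fine_ge0. Qed.

Let mpre A : measurable A -> measurable (@radial R n @^-1` A).
Proof.
by move=> mA; rewrite -[X in measurable X]setTI; exact: measurable_radial.
Qed.

Let sphere_measure0 : sphere_measure (set0 : set 'rV[R]_n) = 0%E.
Proof. by rewrite /sphere_measure preimage_set0 setI0 measure0 mul0e. Qed.

Let sphere_measure_ge0 (A : set 'rV[R]_n) : (0 <= sphere_measure A)%E.
Proof. by rewrite mule_ge0// lee_fin. Qed.

Let sphere_measure_additive : semi_sigma_additive (@sphere_measure R n).
Proof.
move=> F mF tF mUF.
have mB := @measurable_eball0 1.
pose G i := eball 0 1 `&` @radial R n @^-1` F i.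
have mG i : measurable (G i) by apply: measurableI => //; exact: mpre.
have tG : trivIset setT G.
  apply/trivIsetP => i j _ _ ij; rewrite /G setIACA -preimage_setI.
  by move/trivIsetP : tF => /(_ _ _ Logic.I Logic.I ij) ->; rewrite preimage_set0 setI0.
rewrite /sphere_measure preimage_bigcup setI_bigcupr.
rewrite [X in X @ _ --> _](_ : _ = (fun k =>
    ((fine (rV_lebesgue (eball (0 : 'rV[R]_n) 1)))^-1%:E *
     \sum_(0 <= i < k) rV_lebesgue (G i)))%E); last first.
  apply/funext => k; rewrite ge0_sume_distrr//.
  by apply: eq_bigr => i _; rewrite muleC.
rewrite muleC; apply: cvgeZl => //.
exact: measure_sigma_additive.
Qed.

HB.instance Definition _ := isMeasure.Build _ _ _ (@sphere_measure R n)
  sphere_measure0 sphere_measure_ge0 sphere_measure_additive.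

Let sphere_measureT : sphere_measure [set: 'rV[R]_n] = 1%E.
Proof.
have /andP[B0 Boo] := unit_ball_volume.
have Bfin : rV_lebesgue (eball (0 : 'rV[R]_n) 1) \is a fin_num.
  by rewrite ge0_fin_numE.
rewrite /sphere_measure preimage_setT setIT -{1}(fineK Bfin) -EFinM divff//.
by rewrite gt_eqF// fine_gt0// B0 Boo.
Qed.

HB.instance Definition _ := Measure_isProbability.Build _ _ _
  (@sphere_measure R n) sphere_measureT.

Lemma sphere_measure_esphere : (0 < n)%N -> sphere_measure (@esphere R n) = 1%E.
Proof.
move=> n0; rewrite -sphere_measureT.
rewrite /sphere_measure preimage_setT setIT; congr (_ * _)%E.
have mB := @measurable_eball0 1.
have m0 : measurable [set (0 : 'rV[R]_n)].
  rewrite (_ : [set 0] = @eball R n 0 0); first exact: measurable_eball0.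
  apply/seteqP; split => x; rewrite /eball /= subr0.
    by move=> ->; rewrite /enorm /dotp big1 ?sqrtr0// => i _; rewrite mxE mul0r.
  rewrite -sqrtr0 ler_psqrt ?nnegrE ?dotp_ge0// => x0.
  have {}x0 : dotp x x = 0 by apply/eqP; rewrite eq_le x0 dotp_ge0.
  apply/rowP => i; rewrite mxE; apply/eqP; rewrite -sqrf_eq0 expr2.
  move: x0 => /psumr_eq0P -> // j _; by rewrite -expr2 sqr_ge0.
have z0 : rV_lebesgue [set (0 : 'rV[R]_n)] = 0%E.
  rewrite (_ : [set 0] = [set x : 'rV[R]_n | forall i, [set 0] (x 0 i)]).
    rewrite (@rV_lebesgue_box R n (fun=> [set 0])); last by move=> i; exact: measurable_set1.
    by rewrite (bigD1 (Ordinal n0))//= lebesgue_measure_set1 mul0e.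
  apply/seteqP; split => x /=; first by move=> -> i; rewrite mxE.
  by move=> H; apply/rowP => i; rewrite mxE.
have mS : measurable (eball 0 1 `&` @radial R n @^-1` @esphere R n).
  by apply: measurableI => //; apply: mpre; exact: measurable_esphere.
apply/eqP; rewrite eq_le; apply/andP; split.
  by apply: le_measure; rewrite ?inE//; exact: subIsetl.
rewrite -[leRHS]adde0 -z0 -measureU//; last first.
  apply/seteqP; split => // x /= [[_ xS] x0]; move: xS.
  rewrite /esphere /radial x0 /= scaler0 /enorm /dotp big1 ?sqrtr0.
    by move=> /esym/eqP; rewrite oner_eq0.
  by move=> i _; rewrite mxE mul0r.
apply: le_measure; rewrite ?inE//; first exact: measurableU.
move=> x Bx; have [->|x0] := eqVneq x 0; first by right.
left; split => //; rewrite /esphere /radial /= /enorm.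
have d0 : 0 < dotp x x.
  rewrite lt_neqAle dotp_ge0 andbT eq_sym; apply: contra x0 => /eqP /psumr_eq0P H.
  apply/eqP/rowP => i; rewrite mxE; apply/eqP; rewrite -sqrf_eq0 expr2 H// => j _.
  by rewrite -expr2 sqr_ge0.
have -> : dotp ((Num.sqrt (dotp x x))^-1 *: x) ((Num.sqrt (dotp x x))^-1 *: x)
    = ((Num.sqrt (dotp x x)) ^+ 2)^-1 * dotp x x.
  rewrite /dotp mulr_sumr; apply: eq_bigr => i _; rewrite !mxE mulrACA.
  by rewrite -expr2 exprVn.
by rewrite sqr_sqrtr ?dotp_ge0// mulVf ?sqrtr1// gt_eqF.
Qed.

End sphere_measure_facts.

Definition support_fun (R : realType) (m : nat) (K : set 'rV[R]_m)
  (p : 'rV[R]_m) : R := sup [set dotp p x | x in K].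

Definition steiner (R : realType) (m : nat) (K : set 'rV[R]_m) : 'rV[R]_m :=
  \row_j (m%:R * \int[@sphere_measure R m]_(p in @esphere R m)
                    (p 0 j * support_fun K p)).

(* Measurability with respect to the Lebesgue sigma-algebra of the line, which
   is strictly larger than the Borel one carried by [measurableTypeR R]. *)
Definition lebesgue_measurable_fun (R : realType) (D : set R) (f : R -> R) :
  Prop :=
  @measurable_fun _ _
    (g_sigma_algebraType (completed_algebra_gen (@lebesgue_measure R)))
    (measurableTypeR R) D f.

(* Functions of time are total functions on R of which only the values on
   [0, T] are ever constrained or used. *)
Section hamiltonian.
Context (R : realType) (n : nat).
Variables (T : R) (H : R -> 'rV[R]_n -> 'rV[R]_n -> R) (c : R -> R)
          (lam : R -> 'rV[R]_n -> R).

Definition lagrangian (t : R) (x v : 'rV[R]_n) : \bar R :=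
  ereal_sup [set (dotp v p - H t x p)%:E | p in [set: 'rV[R]_n]].

Record admissible : Prop := Admissible {
  ham_measurable : forall x p, lebesgue_measurable_fun `[0, T] (fun t => H t x p);
  ham_continuous : forall t : R, t \in `[0, T] -> continuous (uncurry (H t));
  ham_convex : forall (t : R) (x : 'rV[R]_n), t \in `[0, T] -> convex_function setT (H t x);
  growth_measurable : lebesgue_measurable_fun `[0, T] c;
  ham_growth : forall (t : R) (x p q : 'rV[R]_n), t \in `[0, T] ->
    `|H t x p - H t x q| <= c t * (1 + enorm x) * enorm (p - q);
  ham_lipschitz : forall r : R, 0 < r -> exists k : R -> R,
    [/\ lebesgue_measurable_fun `[0, T] k,
        forall t : R, t \in `[0, T] -> 0 <= k t
      & forall (t : R) (x y p : 'rV[R]_n), t \in `[0, T] -> eball 0 r x -> eball 0 r y ->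
          `|H t x p - H t y p| <= k t * (1 + enorm p) * enorm (x - y)];
  bound_measurable : forall x, lebesgue_measurable_fun `[0, T] (lam ^~ x);
  bound_continuous : forall t : R, t \in `[0, T] -> continuous (lam t);
  lagrangian_bound : forall (t : R) (x v : 'rV[R]_n), t \in `[0, T] ->
    lagrangian t x v \is a fin_num -> (lagrangian t x v <= (lam t x)%:E)%E;
  bound_lipschitz : forall r : R, 0 < r -> exists k : R -> R,
    [/\ lebesgue_measurable_fun `[0, T] k,
        forall t : R, t \in `[0, T] -> 0 <= k t
      & forall (t : R) (x y : 'rV[R]_n), t \in `[0, T] -> eball 0 r x -> eball 0 r y ->
          `|lam t x - lam t y| <= k t * enorm (x - y)]
}.

(* A pair (v, eta) of R^n x R is the vector [row_mx v eta%:M] of R^(n+1). *)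
Definition epi_lagrangian (t : R) (x : 'rV[R]_n) : set 'rV[R]_(n + 1) :=
  [set z | (lagrangian t x (lsubmx z) <= (rsubmx z 0 0)%:E)%E].

Definition omega (t : R) (x : 'rV[R]_n) : R :=
  `|lam t x| + `|H t x 0| + c t * (1 + enorm x) + 1.

Definition Phi (t : R) (x : 'rV[R]_n) (a : 'rV[R]_(n + 1)) :
  set 'rV[R]_(n + 1) :=
  epi_lagrangian t x `&`
  eball (omega t x *: a) (2 * edist (omega t x *: a) (epi_lagrangian t x)).

Definition canonical_e (t : R) (x : 'rV[R]_n) (a : 'rV[R]_(n + 1)) :
  'rV[R]_(n + 1) := steiner (Phi t x a).

Definition canonical_f (t : R) (x : 'rV[R]_n) (a : 'rV[R]_(n + 1)) :
  'rV[R]_n := lsubmx (canonical_e t x a).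

Definition canonical_l (t : R) (x : 'rV[R]_n) (a : 'rV[R]_(n + 1)) : R :=
  rsubmx (canonical_e t x a) 0 0.

End hamiltonian.

Definition cvg_on_compacts (R : realType) (U : topologicalType)
  (V : normedModType R) (D : set U) (F : nat -> U -> V) (f : U -> V) : Prop :=
  forall K : set U, compact K -> K `<=` D -> {uniform K, F @ \oo --> f}.

(* Main.v *)
(* Each E_L(t,x) is the set of affine minorants of H(t,x,.), and the bound
   lambda on L makes its part below height |lambda| carry the whole of it up to
   vertical translations. Hence local uniform convergence of the Hamiltonians
   gives uniform Hausdorff convergence of the E_L: a hyperplane separating a
   point of one epigraph from the other, once tilted away from the vertical,
   compares the two Hamiltonians at a momentum of controlled size. For convex
   E the set E `&` B(y, 2 d(y, E)) is Lipschitz in (y, E) for the Hausdorff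
   distance, and the Steiner point is Lipschitz because support functions are.
   Composing these estimates gives the convergence of the canonical pairs. *)
Require Import Defs.
From mathcomp Require Import all_boot all_order all_algebra.
From mathcomp Require Import all_classical all_reals all_analysis.
From mathcomp Require Import measurable_realfun.
From mathcomp Require Import ring lra.

Set Implicit Arguments.
Unset Strict Implicit.
Unset Printing Implicit Defensive.

Import Order.TTheory GRing.Theory Num.Theory.
Import numFieldNormedType.Exports.

Local Open Scope classical_set_scope.
Local Open Scope ring_scope.

(** * Euclidean inner product and norm on row vectors *)

Section euclidean.
Context (R : realType) (n : nat).
Implicit Types (x y z : 'rV[R]_n) (k : R).

Lemma dotpC x y : dotp x y = dotp y x.
Proof. by apply: eq_bigr => i _; rewrite mulrC. Qed.

Lemma dotpDl x y z : dotp (x + y) z = dotp x z + dotp y z.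
Proof. by rewrite -big_split; apply: eq_bigr => i _; rewrite mxE mulrDl. Qed.

Lemma dotpZl k x y : dotp (k *: x) y = k * dotp x y.
Proof.
by rewrite /dotp mulr_sumr; apply: eq_bigr => i _; rewrite mxE mulrA.
Qed.

Lemma dotpNl x y : dotp (- x) y = - dotp x y.
Proof. by rewrite -scaleN1r dotpZl mulN1r. Qed.

Lemma dotpDr x y z : dotp z (x + y) = dotp z x + dotp z y.
Proof. by rewrite dotpC dotpDl !(dotpC z). Qed.

Lemma dotpZr k x y : dotp x (k *: y) = k * dotp x y.
Proof. by rewrite dotpC dotpZl dotpC. Qed.

Lemma dotpNr x y : dotp x (- y) = - dotp x y.
Proof. by rewrite dotpC dotpNl dotpC. Qed.

Lemma dotp0l x : dotp 0 x = 0.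
Proof. by apply: big1 => i _; rewrite mxE mul0r. Qed.

Lemma dotp0r x : dotp x 0 = 0.
Proof. by rewrite dotpC dotp0l. Qed.

Definition dotpE := (dotpDl, dotpDr, dotpNl, dotpNr, dotpZl, dotpZr).

Lemma enorm_ge0 x : 0 <= enorm x.
Proof. exact: sqrtr_ge0. Qed.

Lemma enorm_sqr x : enorm x ^+ 2 = dotp x x.
Proof. by rewrite sqr_sqrtr// dotp_ge0. Qed.

Lemma enorm_le x k : 0 <= k -> dotp x x <= k ^+ 2 -> enorm x <= k.
Proof.
by move=> k0 xk; rewrite -(ler_pXn2r (n := 2))// ?nnegrE ?enorm_ge0// enorm_sqr.
Qed.

Lemma enorm0 : enorm (0 : 'rV[R]_n) = 0.
Proof. by rewrite /enorm dotp0l sqrtr0. Qed.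

Lemma enorm0_eq0 x : enorm x = 0 -> x = 0.
Proof.
move=> /(congr1 (fun k => k ^+ 2)); rewrite enorm_sqr expr0n /=.
move=> /psumr_eq0P H; apply/rowP => i; rewrite mxE; apply/eqP.
by rewrite -sqrf_eq0 expr2 H// => j _; rewrite -expr2 sqr_ge0.
Qed.

Lemma enormZ k x : enorm (k *: x) = `|k| * enorm x.
Proof.
by rewrite /enorm dotpZl dotpZr mulrA -expr2 sqrtrM ?sqr_ge0// sqrtr_sqr.
Qed.

Lemma enormN x : enorm (- x) = enorm x.
Proof. by rewrite -scaleN1r enormZ normrN1 mul1r. Qed.

Lemma enormB x y : enorm (x - y) = enorm (y - x).
Proof. by rewrite -enormN opprB. Qed.

Lemma cauchy_schwarz x y : dotp x y <= enorm x * enorm y.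
Proof.
have [x0|] := eqVneq (enorm x) 0.
  by rewrite (enorm0_eq0 x0) enorm0 mul0r dotp0l.
have [y0 _|ny nx] := eqVneq (enorm y) 0.
  by rewrite (enorm0_eq0 y0) enorm0 mulr0 dotp0r.
have xp : 0 < enorm x by rewrite lt_neqAle eq_sym nx enorm_ge0.
have yp : 0 < enorm y by rewrite lt_neqAle eq_sym ny enorm_ge0.
have := dotp_ge0 (enorm y *: x - enorm x *: y).
rewrite !dotpE -!enorm_sqr (dotpC y x).
move: (enorm x) (enorm y) (dotp x y) xp yp => a b d a0 b0 H.
have ab : 0 < a * b by rewrite mulr_gt0.
rewrite -(ler_pM2l ab); nra.
Qed.

Lemma enorm_sqrBZ x y k :
  enorm (x - k *: y) ^+ 2 = enorm x ^+ 2 - 2 * k * dotp x y + k ^+ 2 * dotp y y.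
Proof. by rewrite !enorm_sqr !dotpE (dotpC y x); ring. Qed.

Lemma enormD x y : enorm (x + y) <= enorm x + enorm y.
Proof.
apply: enorm_le; first by rewrite addr_ge0 ?enorm_ge0.
rewrite !dotpE (dotpC y x) -!enorm_sqr; have := cauchy_schwarz x y; nra.
Qed.

Lemma enorm_triangle y x z : enorm (x - z) <= enorm (x - y) + enorm (y - z).
Proof. by apply: le_trans (enormD _ _); rewrite addrA subrK. Qed.

Lemma normr_coord_enorm x i : `|x 0 i| <= enorm x.
Proof.
rewrite -sqrtr_sqr ler_wsqrtr// /dotp (bigD1 i)//= -expr2 lerDl.
by apply: sumr_ge0 => j _; rewrite -expr2 sqr_ge0.
Qed.

Lemma normr_enorm x : `|x| <= enorm x.
Proof.
rewrite -[`|x|]/(mx_norm x) mx_normrE; apply: bigmax_le; first exact: enorm_ge0.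
by move=> [i j] _ /=; rewrite ord1 normr_coord_enorm.
Qed.

Lemma enorm_le_normr x : enorm x <= n%:R * `|x|.
Proof.
have n0 : (0 : R) <= n%:R by [].
apply: enorm_le; first by rewrite mulr_ge0.
apply: (@le_trans _ _ (\sum_(i < n) `|x| ^+ 2)).
  apply: ler_sum => i _; rewrite -expr2 -real_normK ?num_real//.
  rewrite ler_pXn2r ?nnegrE// -[leRHS]/(mx_norm x) mx_normrE.
  exact: (le_bigmax _ (fun ij : 'I_1 * 'I_n => `|x ij.1 ij.2|) (ord0, i)).
rewrite sumr_const card_ord -[leLHS]mulr_natl exprMn ler_wpM2r ?sqr_ge0//.
by rewrite -natrX ler_nat; case: (n) => // m; exact: leq_pmulr.
Qed.

Lemma continuous_dotp (U : topologicalType) (f g : U -> 'rV[R]_n) :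
  continuous f -> continuous g -> continuous (fun u => dotp (f u) (g u)).
Proof.
move=> cf cg u; rewrite /dotp.
apply: (cvg_big (op := +%R)) => [|i _]; first exact: add_continuous.
apply: cvgM.
  exact: (@continuous_comp _ _ _ f (fun x => x 0 i) u (cf u)
    (@coord_continuous _ _ _ 0 i _)).
exact: (@continuous_comp _ _ _ g (fun x => x 0 i) u (cg u)
  (@coord_continuous _ _ _ 0 i _)).
Qed.

Lemma continuous_enorm : continuous (@enorm R n).
Proof.
move=> x; apply: continuous_comp; last exact: sqrt_continuous.
by apply: continuous_dotp => y; exact: cvg_id.
Qed.

Lemma compact_eball r : compact (eball (0 : 'rV[R]_n) r).
Proof.
apply: bounded_closed_compact.
  exists r; split; first exact: num_real.
  move=> M rM x; rewrite /eball /= subr0 => xr.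
  by rewrite (le_trans (normr_enorm x))// (le_trans xr)// ltW.
rewrite (_ : eball 0 r = @enorm R n @^-1` [set k | k <= r]).
  by apply: preimage_closed => [x _|];
    [exact: continuous_enorm|exact: closed_le].
by apply/seteqP; split => x; rewrite /eball /= subr0.
Qed.

End euclidean.

(** * Nearest points in closed convex sets *)

Definition is_convex (R : realType) (n : nat) (E : set 'rV[R]_n) : Prop :=
  forall (x y : 'rV[R]_n) (k : R), 0 <= k -> k <= 1 -> E x -> E y ->
  E (k *: x + (1 - k) *: y).

Section nearest_point.
Context (R : realType) (n : nat).
Implicit Types (x y z : 'rV[R]_n) (E : set 'rV[R]_n).

Definition is_nearest y E z :=
  E z /\ forall w, E w -> enorm (y - z) <= enorm (y - w).

Lemma nearest_exists y E : closed E -> E !=set0 -> exists z, is_nearest y E z.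
Proof.
move=> cE [w0 Ew0].
(* The ball of radius [r] contains [w0], and every point outside it is farther from [y] than [w0],
   so minimizing over the compact set [K] is enough. *)
pose r := enorm (y - w0) + enorm y.
pose K := E `&` eball 0 r.
have cK : compact K.
  by rewrite /K setIC; apply: compact_closedI => //; exact: compact_eball.
have Kw0 : K w0.
  split => //; rewrite /eball /= subr0.
  rewrite -{1}(subrK y w0) (le_trans (enormD _ _))// /r lerD2r.
  by rewrite enormB.
have cont : {within K, continuous (fun w => enorm (y - w))}.
  apply: continuous_subspaceT => w.
  apply: continuous_comp; last exact: continuous_enorm.
  by apply: (@continuousB _ 'rV[R]_n _ (fun=> y) id);
    [exact: cst_continuous|exact: cvg_id].
have K0 : K !=set0 by exists w0.
have [z /set_mem [Ez _] zmin] := EVT_min_rV K0 cK cont.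
exists z; split => // w Ew.
have [wr|wr] := leP (enorm w) r.
  by apply: zmin; rewrite inE; split => //; rewrite /eball /= subr0.
rewrite (le_trans (zmin w0 _)) ?inE//.
have := enormD (w - y) y; rewrite subrK enormB => ?.
by move: wr; rewrite /r => wr; lra.
Qed.

Lemma edist_nearest y E z : is_nearest y E z -> Defs.edist y E = enorm (y - z).
Proof.
move=> [Ez zmin]; apply/eqP; rewrite eq_le; apply/andP; split.
  apply: ge_inf; last by exists z.
  by exists 0 => _ [w _ <-]; exact: enorm_ge0.
apply: lb_le_inf; first by exists (enorm (y - z)); exists z.
by move=> _ [w Ew <-]; exact: zmin.
Qed.

(* The derivative at 0 of |y - (z + k (w - z))|^2 must be nonnegative. *)
Lemma nearest_obtuse y E z w : is_convex E -> is_nearest y E z -> E w ->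
  dotp (y - z) (w - z) <= 0.
Proof.
move=> cE [Ez zmin] Ew; rewrite leNgt; apply/negP.
pose q := dotp (w - z) (w - z).
have q0 : 0 <= q := dotp_ge0 _.
set d := dotp (y - z) (w - z) => d0.
(* The squared distance changes by [k ^+ 2 * q - 2 * k * d], which equals [- k * d * (1 + k)] for
   this [k]. Adding [d] to the denominator keeps [k <= 1] and the quotient meaningful when
   [q = 0]. *)
pose k := d / (d + q).
have dq : 0 < d + q by rewrite ltr_pwDl.
have k0 : 0 < k by rewrite divr_gt0.
have k1 : k <= 1 by rewrite ler_pdivrMr// mul1r lerDl.
have Ek := cE w z k (ltW k0) k1 Ew Ez.
have := zmin _ Ek; rewrite -(ler_pXn2r (n := 2)) ?nnegrE ?enorm_ge0//.
have -> : y - (k *: w + (1 - k) *: z) = (y - z) - k *: (w - z).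
  by apply/rowP => i; rewrite !mxE; ring.
rewrite enorm_sqrBZ -/q -/d => H.
have kE : k * (d + q) = d by rewrite divfK// gt_eqF.
nra.
Qed.

End nearest_point.

(** * One-sided Hausdorff bounds and truncation by a ball *)

Definition within_dist (R : realType) (n : nat) (s : R) (A B : set 'rV[R]_n) :
  Prop := forall z, A z -> exists2 w, B w & enorm (z - w) <= s.

(** The abstract form of [Phi], recovered when [y] is [omega] times [a] and [E] is the epigraph of
    the Lagrangian. *)
Definition truncation (R : realType) (n : nat) (y : 'rV[R]_n)
  (E : set 'rV[R]_n) : set 'rV[R]_n :=
  E `&` eball y (2 * Defs.edist y E).

Section truncation.
Context (R : realType) (n : nat).
Implicit Types (x y z : 'rV[R]_n) (E : set 'rV[R]_n).

Lemma truncation_nonempty y E : closed E -> E !=set0 ->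
  truncation y E !=set0.
Proof.
move=> cE E0; have [z zE] := nearest_exists y cE E0.
exists z; split; first by case: zE.
rewrite /eball /= (edist_nearest zE) [leLHS]enormB.
by have := enorm_ge0 (y - z); lra.
Qed.

Lemma truncation_bounded y E :
  exists r, truncation y E `<=` eball 0 r.
Proof.
exists (2 * Defs.edist y E + enorm y) => z [_].
rewrite /eball /= subr0 => zy.
by rewrite -(subrK y z) (le_trans (enormD _ _))// lerD2r.
Qed.

(* A point of E' close to a given point of the first truncation may lie
   outside the second ball; it is moved back by a homothety centred at the
   nearest point of E', which lies in the ball of half the radius. *)
Lemma truncation_within y y' E E' s :
  closed E -> closed E' -> E !=set0 -> E' !=set0 -> is_convex E' ->
  0 < s -> enorm (y - y') <= s -> within_dist s E E' -> within_dist s E' E ->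
  within_dist (19 * s) (truncation y E) (truncation y' E').
Proof.
move=> cE cE' E0 E'0 vE' s0 yy' EE' E'E z [Ez]; rewrite /eball /=.
have [q qE] := nearest_exists y cE E0.
have [q' q'E] := nearest_exists y' cE' E'0.
rewrite (edist_nearest qE) => zy.
have [w Ew zw] := EE' z Ez.
have dd' : enorm (y - q) <= enorm (y' - q') + 2 * s.
  have [v Ev q'v] := E'E q' q'E.1.
  have := qE.2 v Ev; have := enorm_triangle y' y v.
  by have := enorm_triangle q' y' v; lra.
have wy' : enorm (w - y') <= 2 * enorm (y' - q') + 6 * s.
  have := enorm_triangle z w y'; rewrite (enormB w z).
  by have := enorm_triangle y z y'; lra.
have wq' : enorm (w - q') <= 3 * enorm (y' - q') + 6 * s.
  by have := enorm_triangle y' w q'; lra.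
set d := enorm (y' - q') in dd' wy' wq' *.
have d0 : 0 <= d := enorm_ge0 _.
have ds : 0 < d + 6 * s by lra.
(* Since [q'] is at distance [d] from [y'] and [w] at distance at most [2 * d + 6 * s], this weight
   brings the bound [k * d + (1 - k) * (2 * d + 6 * s)] to exactly [2 * d]. The move from [w] costs
   [k * (3 * d + 6 * s) <= 18 * s]; the distance [s] from [z] to [w] makes it 19. *)
pose k := 6 * s / (d + 6 * s).
have kE : k * (d + 6 * s) = 6 * s by rewrite divfK// gt_eqF.
have k0 : 0 <= k by rewrite divr_ge0//; lra.
have k1 : k <= 1 by rewrite ler_pdivrMr//; lra.
exists (k *: q' + (1 - k) *: w).
  split; first by apply: vE' => //; exact: q'E.1.
  rewrite /eball /= (edist_nearest q'E) -/d.
  have -> : k *: q' + (1 - k) *: w - y' = k *: (q' - y') + (1 - k) *: (w - y').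
    by apply/rowP => i; rewrite !mxE; ring.
  apply: le_trans (enormD _ _) _; rewrite !enormZ (enormB q') -/d.
  rewrite !ger0_norm ?subr_ge0//.
  have : (1 - k) * enorm (w - y') <= (1 - k) * (2 * d + 6 * s).
    by apply: ler_wpM2l => //; lra.
  by nra.
apply: le_trans (enorm_triangle w _ _) _.
have -> : w - (k *: q' + (1 - k) *: w) = k *: (w - q').
  by apply/rowP => i; rewrite !mxE; ring.
rewrite enormZ ger0_norm//.
have : k * enorm (w - q') <= k * (3 * d + 6 * s) by exact: ler_wpM2l.
have kd : 0 <= k * d by rewrite mulr_ge0.
by nra.
Qed.

End truncation.

(** * Support functions of bounded sets *)

Section support.
Context (R : realType) (m : nat).
Implicit Types (K : set 'rV[R]_m) (p q : 'rV[R]_m).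

Lemma support_fun_ub K r p x : K `<=` eball 0 r -> K x ->
  dotp p x <= support_fun K p.
Proof.
move=> Kr Kx; apply: ub_le_sup; last by exists x.
exists (enorm p * r) => _ [z Kz <-].
apply: le_trans (cauchy_schwarz _ _) _.
apply: ler_wpM2l; first exact: enorm_ge0.
by have := Kr z Kz; rewrite /eball /= subr0.
Qed.

(** Replacing a point of [K] by a point of [K'] within [s] costs at most [s * enorm p] by
    Cauchy-Schwarz. Boundedness of [K'] matters because [sup] takes a default value on unbounded
    sets. *)
Lemma support_fun_within K K' r s p : K !=set0 -> K' `<=` eball 0 r ->
  within_dist s K K' -> support_fun K p <= support_fun K' p + s * enorm p.
Proof.
move=> [x0 Kx0] K'r KK'; apply: ge_sup; first by exists (dotp p x0), x0.
move=> _ [z Kz <-]; have [w K'w zw] := KK' z Kz.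
rewrite -(subrK w z) dotpDr addrC; apply: lerD.
  exact: (support_fun_ub p K'r).
apply: le_trans (cauchy_schwarz _ _) _; rewrite mulrC.
by apply: ler_wpM2r => //; exact: enorm_ge0.
Qed.

(** Each linear form given by a point of [K] is [r]-Lipschitz, and suprema keep the constant. This
    yields both the measurability and the boundedness of the Steiner integrand. *)
Lemma support_fun_lipschitz K r p q : K !=set0 -> K `<=` eball 0 r ->
  support_fun K p <= support_fun K q + r * enorm (p - q).
Proof.
move=> [x0 Kx0] Kr; apply: ge_sup; first by exists (dotp p x0), x0.
move=> _ [z Kz <-]; rewrite -(subrK q p) dotpDl addrC addrK; apply: lerD.
  exact: (support_fun_ub q Kr).
apply: le_trans (cauchy_schwarz _ _) _; rewrite mulrC.
apply: ler_wpM2r; first exact: enorm_ge0.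
by have := Kr z Kz; rewrite /eball /= subr0.
Qed.

Lemma support_fun_bound K r p : K !=set0 -> K `<=` eball 0 r ->
  `|support_fun K p| <= r * enorm p.
Proof.
move=> K0 Kr.
have K00 : support_fun K 0 = 0.
  rewrite /support_fun (_ : image _ _ = [set 0]) ?sup1//.
  apply/seteqP; split => [_ [z _ <-]|_ ->] /=.
    by rewrite dotp0l.
  by case: K0 => x Kx; exists x => //; rewrite dotp0l.
have := support_fun_lipschitz p 0 K0 Kr; rewrite K00 subr0 => H1.
have := support_fun_lipschitz 0 p K0 Kr; rewrite K00 sub0r enormN => H2.
by rewrite ler_norml; apply/andP; split; lra.
Qed.

Lemma rat_row_dense p e : 0 < e ->
  exists q : 'rV[rat]_m, enorm (p - map_mx ratr q) <= e.
Proof.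
(* The Euclidean norm is at most [m] times the sup norm; dividing by [m.+1] also covers [m = 0]. *)
move=> e0; pose d := e / m.+1%:R.
have d0 : 0 < d by rewrite divr_gt0.
have /choice[g gP] : forall i : 'I_m, exists q : rat,
    p 0 i < ratr q < p 0 i + d.
  move=> i; have [q] := @rat_in_itvoo R (p 0 i) (p 0 i + d) (ltac:(lra)).
  by rewrite in_itv /=; exists q.
exists (\row_i g i).
apply: le_trans (enorm_le_normr _) _.
have : `|p - map_mx ratr (\row_i g i)| <= d.
  rewrite -[`|_|]/(mx_norm _) mx_normrE; apply: bigmax_le; first exact: ltW.
  move=> [i j] _ /=; rewrite ord1 !mxE.
  by rewrite ler_norml; have /andP[? ?] := gP j; apply/andP; split; lra.
move=> /(ler_wpM2l (ler0n R m)) /le_trans; apply.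
by rewrite /d mulrCA ger_pMr// ler_pdivrMr// mul1r ler_nat.
Qed.

(* Such a function is the supremum over rational q of [g q - r |p - q|]. *)
Lemma lipschitz_measurable (g : 'rV[R]_m -> R) r : 0 <= r ->
  (forall p q, g p <= g q + r * enorm (p - q)) ->
  measurable_fun setT (g : 'rV[R]_m -> measurableTypeR R).
Proof.
move=> r0 gL _; apply: (measurability _ (RGenOInfty.measurableE R)) => //.
move=> _ [_ [a ->] <-]; rewrite setTI.
pose h (q : 'rV[rat]_m) (p : 'rV[R]_m) : measurableTypeR R :=
  g (map_mx ratr q) - r * enorm (p - map_mx ratr q).
rewrite (_ : _ @^-1` _ = \bigcup_(q : 'rV[rat]_m) (h q @^-1` `]a, +oo[)).
  apply: countable_bigcupT_measurable => [|q]; first exact: countableP.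
  rewrite -[X in measurable X]setTI.
  have mh : measurable_fun setT (h q).
    apply: measurable_funB => //; apply: measurable_funM => //.
    apply: (measurableT_comp (@measurable_enorm R m)).
    apply/measurable_rVP => i.
    rewrite (_ : _ \o _ = fun p => rV_coord i p - ratr (q 0 i)); last first.
      by apply/funext => p; rewrite /rV_coord /= !mxE.
    by apply: measurable_funB => //; exact: measurable_rV_coord.
  by apply: mh => //; exact: measurable_itv.
apply/seteqP; split => p /=; rewrite ?in_itv /= ?andbT.
  (* Passing to [q] loses [r * e] twice, once in [g] and once in the subtracted term, and
     [2 * r * e < g p - a]. The added 1 covers [r = 0]. *)
  move=> agp; pose e := (g p - a) / (2 * r + 1) / 2.
  have e0 : 0 < e by rewrite !divr_gt0//; lra.
  have [q pq] := rat_row_dense p e0.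
  exists q => //=; rewrite in_itv /= andbT /h.
  have := gL p (map_mx ratr q).
  have : r * enorm (p - map_mx ratr q) <= r * e by exact: ler_wpM2l.
  have : e * (2 * r + 1) = (g p - a) / 2 by rewrite /e; field; lra.
  by nra.
move=> [q _] /=; rewrite in_itv /= andbT /h => /lt_le_trans; apply.
by have := gL (map_mx ratr q) p; rewrite enormB; lra.
Qed.

End support.

(** * Steiner points of nearby sets *)

Section steiner.
Context (R : realType) (m : nat).
Implicit Types (K : set 'rV[R]_m).

Lemma steiner_integrable K (r : R) (j : 'I_m) : K !=set0 -> K `<=` eball 0 r ->
  (@sphere_measure R m).-integrable (@esphere R m)
    (EFin \o (fun p : 'rV[R]_m => p 0 j * support_fun K p)).
Proof.
move=> K0 Kr.
have r0 : 0 <= r.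
  by case: K0 => x /Kr; rewrite /eball /= subr0; exact: le_trans (enorm_ge0 _).
have mS := @measurable_esphere R m.
apply: measurable_bounded_integrable => //.
- by apply: le_lt_trans (probability_le1 _ mS) (ltry 1).
- apply: measurable_funTS; apply: measurable_funM.
    exact: (@measurable_rV_coord R m j).
  by apply: (lipschitz_measurable r0) => p q; exact: support_fun_lipschitz.
exists r; split; first exact: num_real.
move=> M rM p /= p1; rewrite normrM -[M]mul1r.
apply: ler_pM => //; first by rewrite -p1 normr_coord_enorm.
apply: le_trans (support_fun_bound p K0 Kr) _.
by rewrite p1 mulr1 ltW.
Qed.

(** On the unit sphere a coordinate of [p] is at most 1 in absolute value and the two support
    functions differ by at most [s]. The sphere has mass at most 1, so only the factor [m] in the
    definition of [steiner] remains. *)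
Lemma steiner_within K K' (r r' s : R) (j : 'I_m) : K !=set0 -> K' !=set0 ->
  K `<=` eball 0 r -> K' `<=` eball 0 r' -> 0 <= s ->
  within_dist s K K' -> within_dist s K' K ->
  `|steiner K 0 j - steiner K' 0 j| <= m%:R * s.
Proof.
move=> K0 K'0 Kr K'r' s0 KK' K'K.
have mS := @measurable_esphere R m.
have iK := steiner_integrable j K0 Kr.
have iK' := steiner_integrable j K'0 K'r'.
rewrite !mxE -mulrBr -RintegralB//.
rewrite normrM ger0_norm// ler_wpM2l//.
set mu := @sphere_measure R m.
have iB : mu.-integrable (@esphere R m) (EFin \o
    (fun p : 'rV[R]_m => p 0 j * support_fun K p - p 0 j * support_fun K' p)).
  exact: integrableB iK iK'.
apply: le_trans (le_normr_Rintegral mS iB) _.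
have is' : mu.-integrable (@esphere R m) (EFin \o fun=> s).
  exact: finite_measure_integrable_cst.
apply: (@le_trans _ _ (\int[mu]_(p in @esphere R m) s)).
  apply: le_Rintegral => //; first exact: integrable_norm.
  move=> p p1; rewrite -mulrBr normrM -[leRHS]mul1r.
  apply: ler_pM => //; first by rewrite -p1 normr_coord_enorm.
  have := support_fun_within p K0 K'r' KK'.
  have := support_fun_within p K'0 Kr K'K.
  by rewrite p1 mulr1 => ? ?; rewrite ler_norml; apply/andP; split; lra.
rewrite Rintegral_cst// ler_piMr// -lee_fin fineK ?fin_num_measure//.
exact: probability_le1.
Qed.

End steiner.

(** * Epigraphs of Legendre transforms and their dependence on the function *)

Section conjugate_epigraph.
Context (R : realType) (n : nat).
Implicit Types (G : 'rV[R]_n -> R) (z w : 'rV[R]_(n + 1)) (p v : 'rV[R]_n).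

Definition last_coord z : R := rsubmx z 0 0.

Definition snoc v (r : R) : 'rV[R]_(n + 1) := row_mx v r%:M.

Lemma lsubmx_snoc v r : lsubmx (snoc v r) = v.
Proof. exact: row_mxKl. Qed.

Lemma last_coord_snoc v r : last_coord (snoc v r) = r.
Proof. by rewrite /last_coord row_mxKr mxE eqxx mulr1n. Qed.

Lemma snocK z : snoc (lsubmx z) (last_coord z) = z.
Proof.
rewrite /snoc -[RHS]hsubmxK; congr row_mx.
by apply/rowP => i; rewrite ord1 mxE eqxx mulr1n.
Qed.

Lemma dotp_split z w :
  dotp z w = dotp (lsubmx z) (lsubmx w) + last_coord z * last_coord w.
Proof.
rewrite /dotp big_split_ord big_ord1 /last_coord !mxE; congr (_ + _).
by apply: eq_bigr => i _; rewrite !mxE.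
Qed.

Lemma continuous_last_coord : continuous last_coord.
Proof.
move=> z; rewrite (_ : last_coord = fun z => z 0 (rshift n 0)).
  exact: (@coord_continuous R 1 (n + 1)).
by apply/funext => w; rewrite /last_coord mxE.
Qed.

Lemma last_coordD z w : last_coord (z + w) = last_coord z + last_coord w.
Proof. by rewrite /last_coord !mxE. Qed.

Lemma last_coordZ (k : R) z : last_coord (k *: z) = k * last_coord z.
Proof. by rewrite /last_coord !mxE. Qed.

Lemma last_coordN z : last_coord (- z) = - last_coord z.
Proof. by rewrite /last_coord !mxE. Qed.

Lemma lsubmxD z w : lsubmx (z + w) = lsubmx z + lsubmx w.
Proof. by apply/rowP => i; rewrite !mxE. Qed.

Lemma lsubmxZ (k : R) z : lsubmx (k *: z) = k *: lsubmx z.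
Proof. by apply/rowP => i; rewrite !mxE. Qed.

Lemma lsubmxN z : lsubmx (- z) = - lsubmx z.
Proof. by apply/rowP => i; rewrite !mxE. Qed.

Definition snocE := (lsubmxD, lsubmxZ, lsubmxN, last_coordD, last_coordZ,
  last_coordN, lsubmx_snoc, last_coord_snoc).

(* By duality the epigraph of the Legendre transform of G is an intersection
   of closed half-spaces. *)
Definition conj_epi G : set 'rV[R]_(n + 1) :=
  [set z | forall p, dotp (lsubmx z) p - last_coord z <= G p].

Lemma conj_epi_convex G : is_convex (conj_epi G).
Proof.
move=> z w k k0 k1 Ez Ew p; rewrite !snocE !dotpE.
have := ler_wpM2l k0 (Ez p).
have k1' : 0 <= 1 - k by lra.
by have := ler_wpM2l k1' (Ew p); lra.
Qed.

Lemma conj_epi_closed G : closed (conj_epi G).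
Proof.
rewrite (_ : conj_epi G =
  \bigcap_p ((fun z => dotp z (snoc p (-1))) @^-1` [set r | r <= G p])).
  apply: closed_bigI => p _; apply: preimage_closed; last exact: closed_le.
  move=> z _.
  apply: (@continuous_dotp R _ 'rV[R]_(n + 1) id (fun=> snoc p (-1))).
    by move=> ?; exact: cvg_id.
  exact: cst_continuous.
apply/seteqP; split => z /=.
  by move=> Ez p _ /=; rewrite dotp_split !snocE mulrN1; exact: Ez.
by move=> Ez p; have := Ez p Logic.I; rewrite /= dotp_split !snocE mulrN1.
Qed.

(** Serves twice below: to lift an approximation found at bounded height, and to show that the
    normal at a nearest point does not point upwards. *)
Lemma conj_epi_up G z r : conj_epi G z -> 0 <= r ->
  conj_epi G (z + snoc 0 r).
Proof.
by move=> Ez r0 p; rewrite !snocE addr0; have := Ez p; lra.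
Qed.

Definition convex_fun G := forall (x y : 'rV[R]_n) (k : R), 0 <= k -> k <= 1 ->
  G (k *: x + (1 - k) *: y) <= k * G x + (1 - k) * G y.

(* Separation of (p0, G p0 - e) from the epigraph of G. *)
Lemma conj_epi_subgradient G p0 (e : R) : continuous G -> convex_fun G ->
  0 < e -> exists2 z, conj_epi G z &
    G p0 - e <= dotp (lsubmx z) p0 - last_coord z.
Proof.
move=> cG vG e0.
pose E : set 'rV[R]_(n + 1) := [set z | G (lsubmx z) <= last_coord z].
have EG p r : G p <= r -> E (snoc p r) by rewrite /E /= !snocE.
have E0 : E !=set0 by exists (snoc p0 (G p0)); exact: EG.
have cE : closed E.
  rewrite (_ : E =
    (fun z => G (lsubmx z) - last_coord z) @^-1` [set r | r <= 0]).
    apply: preimage_closed; last exact: closed_le.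
    move=> z _.
    apply: (@continuousB _ R^o _ (fun z => G (lsubmx z)) last_coord).
      apply: continuous_comp; last exact: cG.
      exact: continuous_lsubmx.
    exact: continuous_last_coord.
  by apply/seteqP; split => z; rewrite /E /= subr_le0.
have vE : is_convex E.
  move=> z w k k0 k1; rewrite /E /= => Ez Ew; rewrite !snocE.
  apply: le_trans (vG _ _ _ k0 k1) _.
  by apply: lerD; apply: ler_wpM2l => //; lra.
have [z zE] := nearest_exists (snoc p0 (G p0 - e)) cE E0.
have obt := nearest_obtuse vE zE.
set u := snoc p0 (G p0 - e) - z in obt.
pose a := p0 - lsubmx z; pose b := G p0 - e - last_coord z.
have uw p r : G p <= r -> dotp a (p - lsubmx z) + b * (r - last_coord z) <= 0.
  by move=> /EG /obt; rewrite dotp_split /u !snocE.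
have zE1 : G (lsubmx z) <= last_coord z := zE.1.
have b0 : b <= 0.
  have := uw (lsubmx z) (last_coord z + 1) (ltac:(lra)).
  by rewrite subrr dotp0r; lra.
(* A vertical hyperplane is impossible: if [b = 0], testing at [(p0, G p0)] forces [a = 0], so the
   nearest point would be [(p0, G p0 - e)], which lies below the graph. *)
have bn : b < 0.
  rewrite lt_neqAle b0 andbT; apply/eqP => b00.
  have := uw p0 _ (lexx _); rewrite b00 mul0r addr0 -/a => aa.
  have a0 : a = 0.
    apply: enorm0_eq0; apply/eqP; rewrite -sqrf_eq0 enorm_sqr.
    by rewrite eq_le aa dotp_ge0.
  move: b00 zE1; rewrite /b; move/eqP: a0; rewrite subr_eq0 => /eqP <-; lra.
(* The slope of the separating hyperplane; the affine minorant of slope [v] passes through the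
   nearest point [z]. *)
pose v := (- b)^-1 *: a.
have av : a = (- b) *: v by rewrite scalerA mulfV ?scale1r// oppr_eq0 lt_eqF.
exists (snoc v (dotp v (lsubmx z) - last_coord z)).
  move=> p; rewrite !snocE.
  have := uw p _ (lexx _); rewrite av dotpZl dotpDr dotpNr => H.
  have : (- b) * (dotp v p - dotp v (lsubmx z) - (G p - last_coord z)) <= 0.
    by lra.
  by rewrite pmulr_rle0; lra.
rewrite !snocE.
(* At [p0] the minorant exceeds [last_coord z] by [- b * dotp v v >= 0], and [b < 0] says that
   [last_coord z > G p0 - e]. *)
have : 0 <= (- b) * dotp v v by rewrite mulr_ge0 ?dotp_ge0//; lra.
rewrite -dotpZr -av /a dotpDr dotpNr /b in bn *; lra.
Qed.

Lemma conj_epi_nonempty G : continuous G -> convex_fun G -> conj_epi G !=set0.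
Proof.
by move=> cG vG; have [z Ez _] := conj_epi_subgradient 0 cG vG ltr01; exists z.
Qed.

(* A direction that separates a point of the first epigraph from the second
   one is tilted to have last coordinate at most [- d D], so that it becomes a
   multiple of [(p, - 1)] with [|p| <= 1 / d]. *)
Lemma conj_epi_within G G' (M d e : R) :
  continuous G' -> convex_fun G' -> 0 <= M -> 0 < d -> d <= 1 -> 0 < e ->
  (forall z, conj_epi G z -> conj_epi G (snoc (lsubmx z) M)) ->
  G' 0 <= M ->
  (forall p, enorm p <= d^-1 -> G p <= G' p + e / 4) ->
  2 * d * M <= e / 2 ->
  within_dist e (conj_epi G) (conj_epi G').
Proof.
move=> cG' vG' M0 d0 d1 e0 GM G'M GG' dM z Ez.
(* A point above height [M] is a vertical lift of the point at height [M] over the same velocity, so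
   the approximation found there is lifted by the same amount. *)
wlog zM : z Ez / last_coord z <= M.
  move=> H; have [zM|zM] := leP (last_coord z) M; first exact: H.
  have [w Ew zw] := H _ (GM _ Ez) (ltac:(rewrite !snocE//)).
  exists (w + snoc 0 (last_coord z - M)).
    by apply: conj_epi_up => //; lra.
  rewrite (_ : _ - _ = snoc (lsubmx z) M - w)//.
  rewrite -[LHS]snocK -[RHS]snocK !snocE; congr snoc; last by lra.
  by rewrite addr0.
have [w wE] := nearest_exists z (@conj_epi_closed G')
  (conj_epi_nonempty cG' vG').
exists w; first exact: wE.1.
rewrite leNgt; apply/negP => eD.
have obt := nearest_obtuse (@conj_epi_convex G') wE.
have uu := enorm_sqr (z - w).
set u := z - w in obt eD uu; set D := enorm u in eD uu.
have D0 : 0 < D by lra.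
pose p := lsubmx u; pose q := - last_coord u.
have uE : u = snoc p (- q) by rewrite -[u]snocK /q opprK.
have q0 : 0 <= q.
  have := obt _ (conj_epi_up wE.1 ler01); rewrite uE addrC addKr.
  rewrite dotp_split !snocE dotp0r; lra.
have pqD : dotp p p + q ^+ 2 = D ^+ 2.
  by rewrite uu uE dotp_split !snocE; lra.
have pD : enorm p <= D by apply: enorm_le; [exact: ltW|nra].
have qD : q <= D by have := dotp_ge0 p; nra.
pose q' := Num.max q (d * D).
have dD : 0 < d * D by rewrite mulr_gt0.
have [qq' q'd q'q] : [/\ q <= q', d * D <= q' & q' <= q + d * D].
  by rewrite /q'; case: (leP q (d * D)) => ?; split; lra.
have q'D : q' <= D by rewrite /q' ge_max qD /=; nra.
have q'0 : 0 < q' by lra.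
pose p' := q'^-1 *: p.
have pE : p = q' *: p' by rewrite scalerA mulfV ?scale1r// gt_eqF.
have p'd : enorm p' <= d^-1.
  rewrite enormZ gtr0_norm ?invr_gt0// ler_pdivrMl//.
  by rewrite -(ler_pM2r d0) divfK ?gt_eqF//; nra.
(* [w'] nearly attains [G' p']; testing its membership at momentum 0 bounds its height below by
   [- M]. *)
have [w' Ew' G'p'] := conj_epi_subgradient p' cG' vG' (ltac:(lra) : 0 < e / 4).
have Gp' := Ez p'.
have w'M : - M <= last_coord w'.
  by have := Ew' 0; rewrite dotp0r; lra.
have := obt _ Ew'.
have uzw : dotp u z = dotp u w + D ^+ 2 by rewrite uu /u dotpDr dotpNr; lra.
rewrite dotpDr dotpNr => uw'.
have := GG' _ p'd => GGp.
have e1 : dotp u z = q' * dotp (lsubmx z) p' - q * last_coord z.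
  by rewrite uE dotp_split !snocE pE dotpZl dotpC; lra.
have e2 : dotp u w' = q' * dotp (lsubmx w') p' - q * last_coord w'.
  by rewrite uE dotp_split !snocE pE dotpZl dotpC; lra.
(* With the exact multiplier [q'], comparing [G] and [G'] at [p'] costs [q' * e / 2]. Replacing [q]
   by [q'] costs at most [2 * d * M * D], from the height bounds on [z] and [w']. Together these
   give [D ^+ 2 <= D * e], against [e < D]. *)
have k1 : q' * (dotp (lsubmx z) p' - last_coord z) <=
          q' * (dotp (lsubmx w') p' - last_coord w' + e / 2).
  by apply: ler_wpM2l; lra.
have k2 : (q' - q) * last_coord z <= (q' - q) * M by apply: ler_wpM2l; lra.
have k3 : (q' - q) * - M <= (q' - q) * last_coord w' by apply: ler_wpM2l; lra.
have k4 : (q' - q) * M <= d * D * M by apply: ler_wpM2r; lra.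
have k5 : q' * e <= D * e by apply: ler_wpM2r; lra.
have k6 : D ^+ 2 <= 2 * d * M * D + D * e / 2 by lra.
have k7 : 2 * d * M * D <= e / 2 * D by apply: ler_wpM2r; lra.
by nra.
Qed.

End conjugate_epigraph.

(** * Uniform convergence on a compact set *)

Section uniform_limits.
Context (R : realType) (U : topologicalType).

Lemma uniform_cvgP (V : normedModType R) (K : set U) (F : nat -> U -> V)
    (f : U -> V) :
  {uniform K, F @ \oo --> f} <->
  forall e : R, 0 < e ->
    \forall i \near \oo, forall y, K y -> `|f y - F i y| < e.
Proof.
split=> [Ff e e0|H A /uniform_nbhs [E [entE EA]]].
  apply: (Ff [set h | forall y, K y -> `|f y - h y| < e]).
  apply/uniform_nbhs; exists [set uv | `|uv.1 - uv.2| < e]; split.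
    by rewrite -entourage_ballE; exists e => //= -[u v]; rewrite /= -ball_normE.
  by move=> h.
move: entE; rewrite -entourage_ballE => -[e /= e0 eE].
have := H e e0; apply: filterS => i Hi; apply: EA => y Ky; apply: eE => /=.
by rewrite -ball_normE; exact: Hi.
Qed.

(** The limit is bounded through a single [F N] within 1 of it, which is continuous and hence
    bounded on [K]; the tail of the sequence is then bounded through the limit. *)
Lemma uniform_limit_bounded (K D : set U) (F : nat -> U -> R) (f : U -> R) :
  compact K -> K `<=` D -> (forall i, {within D, continuous (F i)}) ->
  {uniform K, F @ \oo --> f} ->
  exists M : R, (forall y, K y -> `|f y| <= M) /\
    \forall i \near \oo, forall y, K y -> `|F i y| <= M.
Proof.
move=> cK KD cF /uniform_cvgP Ff.
have [N _ /(_ N (leqnn N)) /= fN] := Ff 1 ltr01.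
have cFK : compact (F N @` K).
  by apply: continuous_compact => //; exact: continuous_subspaceW (cF N).
have [M [_ HM]] := compact_bounded cFK.
(* [compact_bounded] grants every constant strictly above [M], hence [M + 1] for [F N] and one more
   for [f]. *)
have fM y : K y -> `|f y| <= M + 2.
  move=> Ky; have := HM (M + 1) (ltac:(lra)) (F N y) (ex_intro2 _ _ _ Ky erefl).
  have := fN y Ky; have := ler_normD (f y - F N y) (F N y); rewrite subrK.
  by move=> /=; lra.
exists (M + 3); split; first by move=> y /fM; lra.
have := Ff 1 ltr01; apply: filterS => i Hi y Ky.
have := Hi y Ky; have := fM y Ky; have := ler_normD (F i y - f y) (f y).
by rewrite subrK distrC; lra.
Qed.

End uniform_limits.

(** * Comparison of two canonical pairs at one point *)

Section canonical.
Context (R : realType) (n : nat).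
Implicit Types (T t : R) (H : R -> 'rV[R]_n -> 'rV[R]_n -> R) (c : R -> R)
  (lam : R -> 'rV[R]_n -> R) (x : 'rV[R]_n) (a : 'rV[R]_(n + 1)).

(** A supremum is at most a given height exactly when all its terms are, which replaces the
    extended-real Lagrangian by real inequalities on [H]. *)
Lemma epi_lagrangianE H t x : epi_lagrangian H t x = conj_epi (H t x).
Proof.
apply/seteqP; split => z; rewrite /epi_lagrangian /conj_epi /= => Hz.
  move=> p; rewrite lerBlDl -lerBlDr -lee_fin; apply: le_trans Hz.
  by apply: ereal_sup_ubound; exists p.
apply: ge_ereal_sup => _ [p _ <-]; rewrite lee_fin.
by have := Hz p; rewrite /last_coord; lra.
Qed.

Section at_point.
Context (T : R) H c lam (adm : admissible T H c lam).
Context (t : R) (tT : t \in `[0, T]).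

Lemma ham_continuous_momentum x : continuous (H t x).
Proof.
move=> p; apply: (@continuous_comp _ _ _ (fun p => (x, p)) (uncurry (H t))).
  by apply: (@cvg_pair _ _ _ (nbhs p) (nbhs x) (nbhs p));
    [exact: cvg_cst|exact: cvg_id].
by have cH := ham_continuous adm tT; exact: cH.
Qed.

Lemma ham_convex_momentum x : convex_fun (H t x).
Proof.
move=> p q k k0 k1.
exact: (ham_convex adm x tT (Itv01 k0 k1) (in_setT p) (in_setT q)).
Qed.

(** Membership bounds the Lagrangian above and the momentum 0 bounds it below, so it is finite and
    the bound by [lam] in admissibility applies. *)
Lemma epi_lagrangian_bound x z M : lam t x <= M ->
  conj_epi (H t x) z -> conj_epi (H t x) (snoc (lsubmx z) M).
Proof.
move=> lM; rewrite -epi_lagrangianE /epi_lagrangian /= => Hz.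
rewrite lsubmx_snoc -[rsubmx _ 0 0]/(last_coord _) last_coord_snoc.
apply: (@le_trans _ _ (lam t x)%:E); last by rewrite lee_fin.
apply: (lagrangian_bound adm tT).
rewrite fin_numElt (le_lt_trans Hz (ltry _)) andbT.
apply: (@lt_le_trans _ _ (dotp (lsubmx z) 0 - H t x 0)%:E); first exact: ltNyr.
by apply: ereal_sup_ubound; exists 0.
Qed.

End at_point.

(** Both the epigraphs and the ball centres are within [e]; truncation multiplies this by 19 and the
    Steiner point by the dimension [n + 1]. [M] bounds heights and [d^-1] bounds the momenta to
    compare. *)
Lemma canonical_e_within T H H' c c' lam lam' t x a M d e j :
  admissible T H c lam -> admissible T H' c' lam' -> t \in `[0, T] ->
  enorm a <= 1 -> lam t x <= M -> lam' t x <= M ->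
  `|H t x 0| <= M -> `|H' t x 0| <= M -> 0 < d -> d <= 1 -> 0 < e ->
  (forall p, enorm p <= d^-1 -> `|H t x p - H' t x p| <= e / 4) ->
  2 * d * M <= e / 2 ->
  `|omega H c lam t x - omega H' c' lam' t x| <= e ->
  `|canonical_e H c lam t x a 0 j - canonical_e H' c' lam' t x a 0 j| <=
    (n + 1)%:R * (19 * e).
Proof.
move=> aH aH' tT a1 lM lM' HM HM' d0 d1 e0 HH' dM omE.
have M0 : 0 <= M := le_trans (normr_ge0 _) HM.
have [c1 c2] := (@ham_continuous_momentum _ _ _ _ aH _ tT x,
                 @ham_continuous_momentum _ _ _ _ aH' _ tT x).
have [v1 v2] := (@ham_convex_momentum _ _ _ _ aH _ tT x,
                 @ham_convex_momentum _ _ _ _ aH' _ tT x).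
have EE' : within_dist e (conj_epi (H t x)) (conj_epi (H' t x)).
  apply: (@conj_epi_within _ _ _ _ M d) => //.
  - by move=> z; exact: (epi_lagrangian_bound aH tT lM).
  - by apply: le_trans HM'; exact: ler_norm.
  - by move=> p /HH'; rewrite ler_norml => /andP[? ?]; lra.
have E'E : within_dist e (conj_epi (H' t x)) (conj_epi (H t x)).
  apply: (@conj_epi_within _ _ _ _ M d) => //.
  - by move=> z; exact: (epi_lagrangian_bound aH' tT lM').
  - by apply: le_trans HM; exact: ler_norm.
  - by move=> p /HH'; rewrite ler_norml => /andP[? ?]; lra.
have E0 := conj_epi_nonempty c1 v1; have E'0 := conj_epi_nonempty c2 v2.
have cE := @conj_epi_closed _ _ (H t x).
have cE' := @conj_epi_closed _ _ (H' t x).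
have vE := @conj_epi_convex _ _ (H t x).
have vE' := @conj_epi_convex _ _ (H' t x).
pose y := omega H c lam t x *: a; pose y' := omega H' c' lam' t x *: a.
have yy' : enorm (y - y') <= e.
  rewrite /y /y' -scalerBl enormZ -[leRHS]mulr1.
  by apply: ler_pM => //; exact: enorm_ge0.
have y'y : enorm (y' - y) <= e by rewrite enormB.
rewrite /canonical_e /Phi !epi_lagrangianE.
have [r Pr] := truncation_bounded y (conj_epi (H t x)).
have [r' Pr'] := truncation_bounded y' (conj_epi (H' t x)).
apply: (steiner_within j (truncation_nonempty y cE E0)
  (truncation_nonempty y' cE' E'0) Pr Pr').
- by lra.
- exact: truncation_within.
- exact: truncation_within.
Qed.

End canonical.

(** * Uniform estimates over a compact set and the conclusion *)

Lemma canonical_e_cvg (R : realType) (T : R) (n : nat)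
  (H_ : nat -> R -> 'rV[R]_n -> 'rV[R]_n -> R) (c_ : nat -> R -> R)
  (lam_ : nat -> R -> 'rV[R]_n -> R)
  (H : R -> 'rV[R]_n -> 'rV[R]_n -> R) (c : R -> R)
  (lam : R -> 'rV[R]_n -> R)
  (adm_ : forall i, admissible T (H_ i) (c_ i) (lam_ i))
  (adm : admissible T H c lam)
  (H_cont : forall i, {within `[0, T] `*` setT `*` setT,
     continuous (uncurry (uncurry (H_ i)))})
  (lam_cont : forall i, {within `[0, T] `*` setT,
     continuous (uncurry (lam_ i))})
  (H_cvg : cvg_on_compacts (`[0, T] `*` setT `*` setT)
     (fun i => uncurry (uncurry (H_ i))) (uncurry (uncurry H)))
  (lam_cvg : cvg_on_compacts (`[0, T] `*` setT)
     (fun i => uncurry (lam_ i)) (uncurry lam))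
  (c_cvg : cvg_on_compacts `[0, T] c_ c)
  (K : set (R * 'rV[R]_n * 'rV[R]_(n + 1))) (eta : R) :
  compact K -> K `<=` `[0, T] `*` setT `*` eball 0 1 -> 0 < eta ->
  \forall i \near \oo, forall u j, K u ->
    `|canonical_e H c lam u.1.1 u.1.2 u.2 0 j -
      canonical_e (H_ i) (c_ i) (lam_ i) u.1.1 u.1.2 u.2 0 j| < eta.
Proof.
move=> cK KD eta0.
pose Ktx := fst @` K.
have cKtx : compact Ktx.
  apply: continuous_compact => //; apply: continuous_subspaceT => u.
  exact: cvg_fst.
have KtxD : Ktx `<=` `[0, T] `*` setT by move=> _ [u Ku <-]; case: (KD u Ku).
pose Kt := fst @` Ktx.
have cKt : compact Kt.
  apply: continuous_compact => //; apply: continuous_subspaceT => u.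
  exact: cvg_fst.
have KtD : Kt `<=` `[0, T] by move=> _ [u /KtxD Ku <-]; case: Ku.
have [X Xx] : exists X : R, forall tx, Ktx tx -> enorm tx.2 <= X.
  have cKx : compact ((fun tx => enorm tx.2) @` Ktx).
    apply: continuous_compact => //; apply: continuous_subspaceT => u.
    apply: continuous_comp; [exact: cvg_snd|exact: continuous_enorm].
  have [X [_ HX]] := compact_bounded cKx.
  exists (X + 1) => tx Ktxx.
  have := HX (X + 1) (ltac:(lra)) _ (ex_intro2 _ _ _ Ktxx erefl).
  by apply: le_trans; exact: ler_norm.
have cKH (r : R) : compact (Ktx `*` eball (0 : 'rV[R]_n) r).
  by apply: compact_setX => //; exact: compact_eball.
have KHD (r : R) : Ktx `*` eball (0 : 'rV[R]_n) r `<=`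
    `[0, T] `*` setT `*` setT.
  by move=> u [/KtxD].
have [Ml [lM /= lM_]] := uniform_limit_bounded cKtx KtxD lam_cont
  (lam_cvg _ cKtx KtxD).
(* The ball of radius 0 restricts the Hamiltonians to momentum 0, the only one whose values must be
   bounded. *)
have [Mh [hM /= hM_]] := uniform_limit_bounded (cKH 0) (KHD 0) H_cont
  (H_cvg _ (cKH 0) (KHD 0)).
pose M := Num.max 0 (Num.max Ml Mh).
have [M0 MlM MhM] : [/\ 0 <= M, Ml <= M & Mh <= M].
  by rewrite /M !le_max !lexx !orbT.
(* Makes the final bound [(n + 1) * 19 * e] equal to [eta / 2]. *)
pose e := eta / (38 * (n + 1)%:R).
have n10 : 0 < (n + 1)%:R :> R by rewrite ltr0n addn1.
have e0 : 0 < e by rewrite divr_gt0// mulr_gt0.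
have eE : (n + 1)%:R * (19 * e) = eta / 2 by rewrite /e; field; rewrite gt_eqF.
(* This denominator ensures both [d <= 1] and [4 * d * M <= e]. *)
pose d := e / (4 * M + 1 + e).
have dE : d * (4 * M + 1 + e) = e by rewrite divfK// gt_eqF//; lra.
have d0 : 0 < d by rewrite divr_gt0//; lra.
have d1 : d <= 1 by rewrite ler_pdivrMr; lra.
have dM : 2 * d * M <= e / 2 by nra.
have X0 : 0 < 4 * (1 + `|X|) by have := normr_ge0 X; lra.
have z0 r : 0 <= r -> eball (0 : 'rV[R]_n) r 0.
  by move=> r0; rewrite /eball /= subrr enorm0.
near=> i => -[[t x] a] j Ku /=.
have Kx : Ktx (t, x) by exists ((t, x), a).
have Kt' : Kt t by exists (t, x).
have [[tT _] aB] := KD _ Ku.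
(* The momentum radius [d^-1] does not depend on [i], so one compact set serves all large [i]. *)
have Hi : forall u, (Ktx `*` eball 0 d^-1) u ->
    `|uncurry (uncurry H) u - uncurry (uncurry (H_ i)) u| < e / 4.
  near: i.
  have /uniform_cvgP := H_cvg _ (cKH d^-1) (KHD d^-1); apply; lra.
have li : forall u, Ktx u -> `|uncurry lam u - uncurry (lam_ i) u| < e / 4.
  by near: i; have /uniform_cvgP := lam_cvg _ cKtx KtxD; apply; lra.
have ci : forall u, Kt u -> `|c u - c_ i u| < e / (4 * (1 + `|X|)).
  by near: i; have /uniform_cvgP := c_cvg _ cKt KtD; apply; rewrite divr_gt0.
have lMi : forall u, Ktx u -> `|uncurry (lam_ i) u| <= Ml by near: i.
have hMi : forall u, (Ktx `*` eball 0 0) u ->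
    `|uncurry (uncurry (H_ i)) u| <= Mh by near: i.
have H0 := hM ((t, x), 0) (conj Kx (z0 0 (lexx 0))).
have H0i := hMi ((t, x), 0) (conj Kx (z0 0 (lexx 0))).
have l0 := lM (t, x) Kx; have l0i := lMi (t, x) Kx.
rewrite /= in H0 H0i l0 l0i.
apply: (@le_lt_trans _ _ (eta / 2)); last first.
  by rewrite ltr_pdivrMr// ltr_pMr// ltr1n.
rewrite -eE; apply: (canonical_e_within (M := M) (d := d) (T := T)) => //.
- by move: aB; rewrite /eball /= subr0.
- exact: le_trans (ler_norm _) (le_trans l0 MlM).
- exact: le_trans (ler_norm _) (le_trans l0i MlM).
- exact: le_trans H0 MhM.
- exact: le_trans H0i MhM.
- move=> p pd; apply/ltW/(Hi ((t, x), p)); split => //.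
  by rewrite /eball /= subr0.
have dV0 : 0 <= d^-1 by rewrite invr_ge0 ltW.
have h1 := Hi ((t, x), 0) (conj Kx (z0 _ dV0)).
have h2 := li (t, x) Kx; have h3 := ci t Kt'; rewrite /= in h1 h2 h3.
have xX := Xx (t, x) Kx; rewrite /= in xX.
(* The three varying summands contribute at most [e / 4] each; the tolerance in [ci] absorbs the
   factor [1 + enorm x]. *)
rewrite /omega.
have r1 := ler_dist_dist (H t x 0) (H_ i t x 0).
have r2 := ler_dist_dist (lam t x) (lam_ i t x).
have r3 : `|c t * (1 + enorm x) - c_ i t * (1 + enorm x)| <= e / 4.
  rewrite -mulrBl normrM [X in _ * X]ger0_norm; last first.
    by rewrite addr_ge0// enorm_ge0.
  apply: (@le_trans _ _ (e / (4 * (1 + `|X|)) * (1 + `|X|))).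
    apply: ler_pM => //; first by rewrite addr_ge0// enorm_ge0.
      exact: ltW.
    by rewrite lerD2l (le_trans xX)// ler_norm.
  by rewrite invfM mulrA divfK// gt_eqF// ltr_pwDl.
rewrite ler_norml; move: r1 r2 r3; rewrite !ler_norml.
move=> /andP[? ?] /andP[? ?] /andP[? ?].
by apply/andP; split; lra.
Unshelve. all: by end_near. Qed.

Theorem theorem3p8 (R : realType) (T : R) (n : nat)
  (T_gt0 : 0 < T) (n_gt0 : (0 < n)%N)
  (H_ : nat -> R -> 'rV[R]_n -> 'rV[R]_n -> R) (c_ : nat -> R -> R)
  (lam_ : nat -> R -> 'rV[R]_n -> R)
  (H : R -> 'rV[R]_n -> 'rV[R]_n -> R) (c : R -> R)
  (lam : R -> 'rV[R]_n -> R)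
  (c_ge0_ : forall i (t : R), t \in `[0, T] -> 0 <= c_ i t)
  (c_ge0 : forall t : R, t \in `[0, T] -> 0 <= c t)
  (adm_ : forall i, admissible T (H_ i) (c_ i) (lam_ i))
  (adm : admissible T H c lam)
  (H_cont : forall i, {within `[0, T] `*` setT `*` setT,
     continuous (uncurry (uncurry (H_ i)))})
  (lam_cont : forall i, {within `[0, T] `*` setT,
     continuous (uncurry (lam_ i))})
  (c_cont : forall i, {within `[0, T], continuous (c_ i)})
  (H_cvg : cvg_on_compacts (`[0, T] `*` setT `*` setT)
     (fun i => uncurry (uncurry (H_ i))) (uncurry (uncurry H)))
  (lam_cvg : cvg_on_compacts (`[0, T] `*` setT)
     (fun i => uncurry (lam_ i)) (uncurry lam))
  (c_cvg : cvg_on_compacts `[0, T] c_ c) :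
  cvg_on_compacts (`[0, T] `*` setT `*` eball 0 1)
    (fun i => uncurry (uncurry (canonical_f (H_ i) (c_ i) (lam_ i))))
    (uncurry (uncurry (canonical_f H c lam)))
  /\
  cvg_on_compacts (`[0, T] `*` setT `*` eball 0 1)
    (fun i => uncurry (uncurry (canonical_l (H_ i) (c_ i) (lam_ i))))
    (uncurry (uncurry (canonical_l H c lam))).
Proof.
have e_cvg := canonical_e_cvg adm_ adm H_cont lam_cont H_cvg lam_cvg c_cvg.
split=> K cK KD; apply/uniform_cvgP => e e0;
  have := e_cvg K e cK KD e0; apply: filterS => i Hi [[t x] a] Ku;
  have {Hi Ku} uv : forall j, `|canonical_e H c lam t x a 0 j -
    canonical_e (H_ i) (c_ i) (lam_ i) t x a 0 j| < e
    := fun j => Hi (t, x, a) j Ku.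
- change (`|lsubmx (canonical_e H c lam t x a) -
            lsubmx (canonical_e (H_ i) (c_ i) (lam_ i) t x a)| < e).
  move: (canonical_e _ _ _ _ _ _) (canonical_e _ _ _ _ _ _) uv => u v uv.
  (* The norm on values is the sup norm, so the coordinatewise estimate suffices. *)
  rewrite -[`|_|]/(mx_norm _) mx_normrE; apply: bigmax_lt => // -[j k] _ /=.
  by rewrite ord1 !mxE.
- change (`|rsubmx (canonical_e H c lam t x a) 0 0 -
            rsubmx (canonical_e (H_ i) (c_ i) (lam_ i) t x a) 0 0| < e).
  move: (canonical_e _ _ _ _ _ _) (canonical_e _ _ _ _ _ _) uv => u v uv.
  by rewrite !mxE.
Qed.
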